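(* Let $(X,d,\phi)$ be a flow and let $K\subset X$ be a non-empty compact subset. Then $$\overline{\mathrm{mdim}}^B(\phi,K,d)=\limsup_{\epsilon\to0}\frac{1}{\log\frac1\epsilon}\sup\{\underline{h}^{BK}_\mu(\phi,\epsilon):\mu\in\mathcal{M}(X),\ \mu(K)=1\}.$$
   Context: A flow $(X,d,\phi)$: $(X,d)$ is a compact metric space and $\phi:X\times\mathbb{R}\to X$ is continuous with $\phi_t(x)=\phi(x,t)$, $\phi_0=\mathrm{id}$, $\phi_{t+s}=\phi_t\circ\phi_s$. $\mathcal{M}(X)$ is the set of Borel probability measures on $X$. For $x\in X$, $t>0$, $\epsilon>0$, the Bowen ball is $B_t(x,\epsilon,\phi)=\{y\in X: d(\phi_s x,\phi_s y)<\epsilon \text{ for all } 0\le s\le t\}$. Bowen upper metric mean dimension of a set $Z\subset X$: for $\lambda\in\mathbb{R}$, $N\in\mathbb{N}$, $\epsilon>0$, let $M(\phi,d,Z,\lambda,N,\epsilon)=\inf\sum_{i\in I}e^{-n_i\lambda}$, the infimum over all finite or countable families $\{B_{n_i}(x_i,\epsilon,\phi)\}_{i\in I}$ covering $Z$ with integers $n_i\ge N$; $M(\phi,d,Z,\lambda,\epsilon)=\lim_{N\to\infty}M(\phi,d,Z,\lambda,N,\epsilon)$; $M(\phi,d,Z,\epsilon)=\inf\{\lambda: M(\phi,d,Z,\lambda,\epsilon)=0\}=\sup\{\lambda:M(\phi,d,Z,\lambda,\epsilon)=+\infty\}$; and $\overline{\mathrm{mdim}}^B(\phi,Z,d)=\limsup_{\epsilon\to0}\frac{M(\phi,d,Z,\epsilon)}{\log(1/\epsilon)}$.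 Lower Brin–Katok local entropy: for $\mu\in\mathcal{M}(X)$, $\underline{h}^{BK}_\mu(\phi,\epsilon)=\int\liminf_{t\to\infty}-\frac1t\log\mu(B_t(x,\epsilon,\phi))\,d\mu(x)$. *)

(* Defs.v *)
From HB Require Import structures.
From mathcomp Require Import all_boot all_order all_algebra.
From mathcomp Require Import all_classical all_reals all_analysis.
Set Implicit Arguments. Unset Strict Implicit. Unset Printing Implicit Defensive.
Import Order.TTheory GRing.Theory Num.Theory.
Import numFieldNormedType.Exports.
Local Open Scope classical_set_scope.
Local Open Scope ring_scope.

Section Defs.
Context {R : realType} {X : Type}.
Implicit Types (d : X -> X -> R).

Definition is_metric d :=
  [/\ forall x y, 0 <= d x y,
      forall x y, d x y = 0 <-> x = y,
      forall x y, d x y = d y x &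
      forall x y z, d x z <= d x y + d y z].

Definition dopen d (U : set X) :=
  forall x, U x -> exists2 r : R, 0 < r & [set y | d x y < r] `<=` U.

Definition dcompact d (K : set X) :=
  forall (I : Type) (U : I -> set X), (forall i, dopen d (U i)) ->
    K `<=` \bigcup_i U i ->
    exists2 F : set I, finite_set F & K `<=` \bigcup_(i in F) U i.

Definition is_flow d (phi : X -> R -> X) :=
  [/\ forall x t e, 0 < e -> exists2 del : R, 0 < del &
        forall y s, d x y < del -> `|t - s| < del -> d (phi x t) (phi y s) < e,
      forall x, phi x 0 = x &
      forall x t s, phi x (t + s) = phi (phi x s) t].

Definition bowen_ball d (phi : X -> R -> X) (t : R) (x : X) (eps : R) : set X :=
  [set y | forall s, 0 <= s <= t -> d (phi x s) (phi y s) < eps].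

Local Open Scope ereal_scope.

Definition bowen_M_N d phi (Z : set X) (lam : R) (N : nat) (eps : R) : \bar R :=
  ereal_inf [set v | exists (I : set nat) (x : nat -> X) (n : nat -> nat),
     [/\ forall i, I i -> (N <= n i)%N,
         Z `<=` \bigcup_(i in I) bowen_ball d phi (n i)%:R (x i) eps &
         v = \esum_(i in I) (expR (- ((n i)%:R * lam)))%:E]].

Definition bowen_M_lam d phi (Z : set X) (lam : R) (eps : R) : \bar R :=
  limn (fun N => bowen_M_N d phi Z lam N eps).

Definition bowen_M d phi (Z : set X) (eps : R) : \bar R :=
  ereal_inf [set lam%:E | lam in [set lam : R | bowen_M_lam d phi Z lam eps = 0]].

Definition bowen_umdim d phi (Z : set X) : \bar R :=
  limf_esup (fun eps : R => bowen_M d phi Z eps * (ln (1 / eps))^-1%:E) (0^'+).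

End Defs.

Section BK.
Context {R : realType} {dX : measure_display} {X : measurableType dX}.
Local Open Scope ereal_scope.

(* -(1/t) log mu(B), with the convention -log 0 = +oo *)
Definition neg_log_rate (mu : probability X R) (B : set X) (t : R) : \bar R :=
  if mu B == 0 then +oo else (- (ln (fine (mu B)) / t))%:E.

Definition lower_BK (d : X -> X -> R) (phi : X -> R -> X)
    (mu : probability X R) (eps : R) : \bar R :=
  \int[mu]_x limf_einf (fun t : R => neg_log_rate mu (bowen_ball d phi t x eps) t)
                        (+oo%R : set_system R).

End BK.

(* Main.v *)
Require Import Defs.
From HB Require Import structures.
From mathcomp Require Import all_boot all_order all_algebra.
From mathcomp Require Import all_classical all_reals all_analysis.
From mathcomp Require Import measurable_realfun lra.
Set Implicit Arguments. Unset Strict Implicit. Unset Printing Implicit Defensive.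
Import Order.TTheory GRing.Theory Num.Theory.
Import numFieldNormedType.Exports.
Local Open Scope classical_set_scope.
Local Open Scope ring_scope.

(* For every scale [e > 0],
     [M(K, 4 e) <= sup_mu h_mu(e) <= M(K, e / 2)],
   and rescaling [e] by a constant does not change the upper limit of the
   quotients by [log (1 / e)].
   The second inequality is a mass distribution argument.  For the first one,
   let [M_N(K, s, 4 e) >= c > 0].  For each [L >= N], take a finite subset of [K]
   that is [e]-dense for the Bowen metric of time [L], and give weights to its
   points greedily, subject to [p(B_n(x, e)) <= exp (- n s)] for [N <= n <= L].
   Every point then lies in a nearly saturated ball.  As [B_m(y, e)] is contained
   in [B_n(x, 3 e)] when it meets [B_n(x, e)] and [n <= m], Vitali's selection
   yields disjoint saturated balls whose enlargements cover [K], so the total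
   weight is at least [c / 2].  An ultrafilter limit of the normalised weights is
   a finitely additive probability on all subsets of [X]; the Borel probability
   it induces through its values on open sets satisfies
   [mu(B_n(x, e)) <= (2 / c) exp (- n s)] for all [n >= N]. *)

(** * Open and compact sets of the metric [d] *)

Section metric.
Context {R : realType} {X : Type} (d : X -> X -> R).
Hypothesis md : is_metric d.

Lemma is_metric_refl x : d x x = 0.
Proof. by case: md => _ d0 _ _; apply/d0. Qed.

Lemma is_metric_sym x y : d x y = d y x.
Proof. by case: md. Qed.

Lemma is_metric_triangle y x z : d x z <= d x y + d y z.
Proof. by case: md. Qed.

Lemma dopenT : dopen d [set: X].
Proof. by move=> x _; exists 1. Qed.

Lemma dopenI U V : dopen d U -> dopen d V -> dopen d (U `&` V).
Proof.
move=> oU oV x [Ux Vx]; have [r r0 rU] := oU x Ux; have [s s0 sV] := oV x Vx.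
exists (Num.min r s); first by rewrite lt_min r0.
by move=> y /=; rewrite lt_min => /andP[yr ys]; split; [exact: rU|exact: sV].
Qed.

Lemma dopen_bigcup (I : Type) (D : set I) (U : I -> set X) :
  (forall i, D i -> dopen d (U i)) -> dopen d (\bigcup_(i in D) U i).
Proof.
move=> oU x [i Di Uix]; have [r r0 rU] := oU i Di x Uix.
by exists r => // y /rU Uiy; exists i.
Qed.

(** A finite subcover lies in its member of largest index. This form of compactness is used below to
    make a radius [n.+1%:R^-1] uniform. *)
Lemma dcompact_nondecreasing (K : set X) (U : nat -> set X) :
    dcompact d K -> (forall n, dopen d (U n)) ->
    (forall m n, (m <= n)%N -> U m `<=` U n) ->
  K `<=` \bigcup_n U n -> exists n, K `<=` U n.
Proof.
move=> cK oU ndU /(cK nat U oU)[F finF KF].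
have [s sF] := (finite_seqP F).1 finF.
exists (\max_(i <- s) i) => x /KF[i Fi Uix]; apply: ndU Uix.
by apply: leq_bigmax_seq => //; move: Fi; rewrite sF.
Qed.

Lemma dcompact_closed (K : set X) : dcompact d K -> dopen d (~` K).
Proof.
move=> cK x nKx.
have [n Kn] : exists n, K `<=` [set y | n.+1%:R^-1 < d x y].
  apply: dcompact_nondecreasing => //.
  - move=> n y /= ny; exists (d x y - n.+1%:R^-1); first by rewrite subr_gt0.
    move=> z /=; have := is_metric_triangle z x y; rewrite (is_metric_sym z y).
    by move: (n.+1%:R^-1) => r; lra.
  - move=> m n mn y /=; apply: le_lt_trans.
    by rewrite lef_pV2 ?posrE// ler_nat.
  - move=> y Ky.
    have xy : 0 < d x y.
      rewrite lt_neqAle eq_sym; case: (md) => -> d0 _ _; rewrite andbT.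
      by apply/eqP => /d0 xy; apply: nKx; rewrite xy.
    have [n _ /(_ n (leqnn n))/= nd] := near_infty_natSinv_lt (PosNum xy).
    by exists n.
exists n.+1%:R^-1; first by rewrite invr_gt0.
by move=> y /= yn Ky; have := Kn _ Ky; rewrite /= ltNge (ltW yn).
Qed.

End metric.

(** * Bowen balls *)

Section bowen_ball.
Context {R : realType} {X : Type} (d : X -> X -> R) (phi : X -> R -> X).
Hypothesis md : is_metric d.

Lemma bowen_ball_le (s t : R) x e : s <= t ->
  bowen_ball d phi t x e `<=` bowen_ball d phi s x e.
Proof.
by move=> st y yB u /andP[u0 us]; apply: yB; rewrite u0 (le_trans us).
Qed.

Lemma bowen_ball_sym (t : R) x y e :
  bowen_ball d phi t x e y -> bowen_ball d phi t y e x.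
Proof. by move=> xy s st; rewrite (is_metric_sym md); exact: xy. Qed.

Lemma bowen_ball_trans (t : R) x y z e e' :
    bowen_ball d phi t x e y -> bowen_ball d phi t y e' z ->
  bowen_ball d phi t x (e + e') z.
Proof.
move=> xy yz s st; have := is_metric_triangle md (phi y s) (phi x s) (phi z s).
by have := xy s st; have := yz s st; lra.
Qed.

Lemma bowen_ball_center (t : R) x e : 0 < e -> bowen_ball d phi t x e x.
Proof. by move=> e0 s _; rewrite (is_metric_refl md). Qed.

(** Joint continuity of the flow gives a radius valid for all times close to a given [s];
    compactness of the segment from 0 to [t] makes it uniform in time. *)
Lemma dopen_bowen_ball (t : R) x e : is_flow d phi ->
  dopen d (bowen_ball d phi t x e).
Proof.
move=> [cphi _ _] y yB.
have /compact_near_coveringP/(_ R 0^'+ (fun del s =>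
   forall z, d y z < del -> d (phi x s) (phi z s) < e)) :=
  @segment_compact R 0 t.
case.
- move=> s /= sin.
  have xys : d (phi x s) (phi y s) < e by apply: yB; rewrite in_itv in sin.
  (* The slack at time [s] is shared between the moves from [phi x s] to [phi x u] and from
     [phi y s] to [phi z u]. *)
  pose e' := (e - d (phi x s) (phi y s)) / 2.
  have e'0 : 0 < e' by rewrite /e'; lra.
  have [r r0 xr] := cphi x s _ e'0.
  have [r' r'0 yr'] := cphi y s _ e'0.
  exists (ball s (Num.min r r'), [set del | del < r']) => /=.
    split; first by apply: nbhsx_ballx; rewrite lt_min r0.
    exact: nbhs_right_lt.
  move=> [u del] /= [su delr'] z yz.
  move: su; rewrite /ball/= lt_min => /andP[sur sur'].
  have xsu : d (phi x s) (phi x u) < e' by apply: xr => //; rewrite (is_metric_refl md).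
  have ysu : d (phi y s) (phi z u) < e' by apply: yr' => //; exact: lt_trans delr'.
  have := is_metric_triangle md (phi x s) (phi x u) (phi z u).
  have := is_metric_triangle md (phi y s) (phi x s) (phi z u).
  by move: xsu ysu; rewrite (is_metric_sym md (phi x u) (phi x s)) /e'; lra.
- move=> r /= r0 rP.
  exists (r / 2); first by rewrite divr_gt0.
  move=> z /= yz s st; apply: (rP (r / 2)) => //=.
  + by rewrite sub0r normrN gtr0_norm ?divr_gt0//; lra.
  + by rewrite divr_gt0.
Qed.

Lemma bowen_cover_compact (K : set X) (t e : R) :
    is_flow d phi -> 0 < e -> dcompact d K ->
  exists2 F : set X, finite_set F & F `<=` K /\
    K `<=` \bigcup_(z in F) bowen_ball d phi t z e.
Proof.
move=> fphi e0 cK.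
(* The factor [[set _ | K z]] is empty or full: it discards the centres outside [K]. *)
have [|z Kz|F finF KF] :=
    cK X (fun z => bowen_ball d phi t z e `&` [set _ | K z]).
- move=> z; apply: dopenI; first exact: dopen_bowen_ball.
  by move=> y Kz; exists 1.
- by exists z => //; split => //; exact: bowen_ball_center.
exists (F `&` K); first exact: finite_setIl.
split=> [z []//|y /KF[z Fz [yz Kz]]].
by exists z.
Qed.

End bowen_ball.

(** * Finitely supported weights and Vitali selection *)

Section weight.
Context {R : realType} {X : choiceType}.
Implicit Types (p : seq (X * R)) (A B : set X).

(** The list encodes an atomic measure; repeated points accumulate mass. *)
Definition weight p A : R := \sum_(z <- p | z.1 \in A) z.2.

Definition nonneg_weights p := forall z, z \in p -> 0 <= z.2.

Lemma weight_ge0 p A : nonneg_weights p -> 0 <= weight p A.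
Proof.
by move=> p0; rewrite /weight big_seq_cond sumr_ge0// => z /andP[/p0].
Qed.

Lemma weight_cons z p A :
  weight (z :: p) A = (if z.1 \in A then z.2 else 0) + weight p A.
Proof. by rewrite /weight big_cons; case: ifP => // _; rewrite add0r. Qed.

Lemma weight0 p : weight p set0 = 0.
Proof. by rewrite /weight big1// => z; rewrite in_set0. Qed.

Lemma weightU p A B : A `&` B = set0 -> weight p (A `|` B) = weight p A + weight p B.
Proof.
move=> AB; elim: p => [|z p ih]; first by rewrite /weight !big_nil addr0.
rewrite !weight_cons ih in_setU; case: (boolP (z.1 \in A)) => /= zA; last first.
  by rewrite add0r addrCA.
rewrite ifF ?add0r ?addrA//; apply/negP => zB.
have : (A `&` B) z.1 by split; exact: set_mem.
by rewrite AB.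
Qed.

Lemma le_weight p A B : nonneg_weights p -> A `<=` B -> weight p A <= weight p B.
Proof.
move=> p0 AB.
rewrite -(setDUK AB) weightU; last by rewrite setDE setICA setICr setI0.
by rewrite lerDl weight_ge0.
Qed.

Lemma weight_supp p A : (forall z, z \in p -> A z.1) -> weight p A = weight p setT.
Proof.
move=> pA; rewrite /weight [LHS]big_seq_cond [RHS]big_seq_cond.
apply: eq_bigl => z; rewrite in_setT; case: (boolP (z \in p)) => //= zp.
exact/mem_set/pA.
Qed.

Lemma weight_scale (c : R) p A :
  weight [seq (z.1, c * z.2) | z <- p] A = c * weight p A.
Proof. by rewrite /weight big_map mulr_sumr. Qed.

(* Greedy choice: the points receive their weights one after the other, each
   weight being the largest one compatible with all the constraints. *)
Lemma saturated_weights (I : Type) (B : I -> set X) (w : I -> R) (w0 : R)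
    (E : seq X) :
    0 < w0 -> (forall i, w0 <= w i) ->
    (forall z, z \in E -> exists i, B i z) ->
  exists p, [/\ nonneg_weights p,
    forall z, z \in p -> z.1 \in E,
    forall i, weight p (B i) <= w i &
    forall z, z \in E -> exists2 i, B i z & w i <= 2 * weight p (B i)].
Proof.
move=> w00 w0w; elim: E => [_|z E ih EB].
  exists [::]; split=> // i; rewrite /weight big_nil.
  exact: le_trans (ltW w00) (w0w i).
have [|p [p0 pE pw Ep]] := ih; first by move=> y yE; apply: EB; rewrite inE yE orbT.
pose S := [set w i - weight p (B i) | i in [set i | B i z]].
have S0 : lbound S 0 by move=> _ [i _ <-]; rewrite subr_ge0.
have infS : has_inf S.
  split; last by exists 0.
  have [|i Biz] := EB z; first by rewrite inE eqxx.
  by exists (w i - weight p (B i)), i.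
have a0 : 0 <= inf S by apply: lb_le_inf => //; case: infS.
exists ((z, inf S) :: p); split.
- by move=> y; rewrite inE => /orP[/eqP->//|/p0].
- by move=> y; rewrite !inE => /orP[/eqP->|/pE ->]; rewrite ?eqxx ?orbT.
- move=> i; rewrite weight_cons /=; case: ifPn => [/set_mem Biz|_]; last by rewrite add0r.
  by rewrite -lerBrDr; apply: ge_inf; [case: infS|exists i].
- move=> y; rewrite inE => /orP[/eqP->{y}|/Ep[i Biy wi]]; last first.
    exists i => //; apply: (le_trans wi); rewrite ler_pM2l// weight_cons.
    by rewrite lerDr; case: ifP.
  (* The infimum need not be attained. A slack below [inf S + w0 / 2], hence below
     [inf S + w i / 2], is enough for saturation up to the factor 2. *)
  have w20 : 0 < w0 / 2 by rewrite divr_gt0.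
  have [_ [i Biz <-] iS] := inf_adherent w20 infS.
  exists i => //; rewrite weight_cons /= ifT; last exact/mem_set.
  by have := w0w i; lra.
Qed.

(** Vitali selection: scan the sets by increasing rank and keep those that meet no set kept before.
    For Bowen balls the rank is the time, so the larger balls come first. The alternative
    [B j = B i] handles kept sets, which may be empty. *)
Lemma disjoint_subfamily (I : eqType) (B : I -> set X) (rk : I -> nat)
    (s : seq I) : exists D : seq I,
  [/\ {subset D <= s},
      pairwise (fun i j => `[< B i `&` B j = set0 >]) D &
      forall i, i \in s -> exists2 j, j \in D &
        B j = B i \/ (rk j <= rk i)%N /\ B i `&` B j !=set0].
Proof.
have [t st srt] : exists2 t, s =i t & sorted (fun i j => rk i <= rk j)%N t.
  exists (sort (fun i j => rk i <= rk j)%N s); first by move=> i; rewrite mem_sort.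
  by apply: sort_sorted => i j; exact: leq_total.
have rk_trans : transitive (fun i j => rk i <= rk j)%N.
  by move=> j i k; exact: leq_trans.
suff [D [Dt Dp tD]] : exists D : seq I, [/\ {subset D <= t},
    pairwise (fun i j => `[< B i `&` B j = set0 >]) D &
    forall i, i \in t -> exists2 j, j \in D &
      B j = B i \/ (rk j <= rk i)%N /\ B i `&` B j !=set0].
  exists D; split=> // [i /Dt|i]; first by rewrite st.
  by rewrite st => /tD.
move: srt {s st}; elim/last_ind: t => [_|t i ih srt].
  by exists [::].
have ti j : j \in t -> (rk j <= rk i)%N.
  move=> jt; move: srt; rewrite (sorted_pairwise rk_trans) -cats1 pairwise_cat.
  by case/and3P => /allrelP/(_ j i jt) + _ _; apply; rewrite inE.
have [|D [Dt Dp tD]] := ih.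
  by move: srt; rewrite !(sorted_pairwise rk_trans) -cats1 pairwise_cat => /and3P[].
have [[j jD ij]|nij] := pselect (exists2 j, j \in D & B i `&` B j !=set0).
  exists D; split=> // [k /Dt|k]; first by rewrite mem_rcons inE => ->; rewrite orbT.
  rewrite mem_rcons inE => /orP[/eqP->|/tD//].
  by exists j => //; right; split=> //; exact/ti/Dt.
exists (i :: D); split.
- move=> k; rewrite mem_rcons !inE => /orP[->//|/Dt ->]; exact: orbT.
- rewrite /= Dp andbT; apply/allP => k kD; apply/asboolP.
  by apply: contrapT => /eqP/set0P ik; apply: nij; exists k.
- move=> k; rewrite mem_rcons inE => /orP[/eqP->|/tD[j jD jk]].
    by exists i; [rewrite inE eqxx|left].
  by exists j => //; rewrite inE jD orbT.
Qed.

Lemma sum_disjoint_weight (I : eqType) (B : I -> set X) p (D : seq I) :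
    nonneg_weights p -> pairwise (fun i j => `[< B i `&` B j = set0 >]) D ->
  \sum_(i <- D) weight p (B i) <= weight p setT.
Proof.
move=> p0 dD.
suff -> : \sum_(i <- D) weight p (B i) = weight p (\big[setU/set0]_(i <- D) B i).
  exact: le_weight.
elim: D dD => [|i D ih] /=; first by rewrite !big_nil weight0.
move=> /andP[iD /ih {}ih]; rewrite !big_cons weightU ?ih//.
rewrite big_distrr/= big_seq big1// => j /(allP iD)/asboolP//.
Qed.

End weight.

(** * Frostman weights up to a finite time *)

Lemma bowen_M_N_le_sum (R : realType) (X : choiceType) (d : X -> X -> R)
    (phi : X -> R -> X) (K : set X) (s : R) (N : nat) (e : R)
    (D : seq (X * nat)) :
    K !=set0 -> (forall i, i \in D -> (N <= i.2)%N) ->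
    (forall y, K y -> exists2 i, i \in D & bowen_ball d phi i.2%:R i.1 e y) ->
  (bowen_M_N d phi K s N e <= (\sum_(i <- D) expR (- (i.2%:R * s)))%:E)%E.
Proof.
move=> [x0 _] ND KD; apply: ereal_inf_lbound => /=.
exists `I_(size D), (fun k => (nth (x0, 0%N) D k).1),
  (fun k => (nth (x0, 0%N) D k).2); split.
- by move=> k /= kD; exact/ND/mem_nth.
- move=> y /KD[i iD yi]; exists (index i D); rewrite /= ?index_mem//.
  by rewrite nth_index.
- by rewrite esum_fset// -fsbig_ord sumEFin (big_nth (x0, 0%N)) big_mkord.
Qed.

Lemma finite_dynamical_frostman (R : realType) (X : choiceType)
    (d : X -> X -> R) (phi : X -> R -> X) (K : set X) (s e c : R) (N L : nat) :
    is_metric d -> is_flow d phi -> dcompact d K -> K !=set0 ->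
    0 <= s -> 0 < e -> 0 < c -> (N <= L)%N ->
    (c%:E <= bowen_M_N d phi K s N (4 * e))%E ->
  exists p : seq (X * R), [/\ nonneg_weights p,
    forall z, z \in p -> K z.1, weight p setT = 1 &
    forall x n, (N <= n <= L)%N ->
      weight p (bowen_ball d phi n%:R x e) <= 2 / c * expR (- (n%:R * s))].
Proof.
move=> md fphi cK K0 s0 e0 c0 NL cM.
have [F finF [FK KF]] := bowen_cover_compact md L%:R fphi e0 cK.
have [E EF] := (finite_seqP F).1 finF.
(* Taking the maximum with [N] keeps all times between [N] and [L] while the index type stays
   simple. *)
pose rk (i : X * 'I_L.+1) := maxn N i.2.
have rkL i : (rk i <= L)%N by rewrite geq_max NL -ltnS ltn_ord.
pose B i := bowen_ball d phi (rk i)%:R i.1 e.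
pose w i := expR (- ((rk i)%:R * s)).
have w0w i : expR (- (L%:R * s)) <= w i.
  by rewrite ler_expR lerN2 ler_wpM2r// ler_nat.
have [|p [p0 pE pw Ep]] :=
    saturated_weights (B := B) (E := E) (expR_gt0 _) w0w.
  by move=> z zE; exists (z, ord0); exact: bowen_ball_center.
have [f fP] : exists f : X -> X * 'I_L.+1, forall z, z \in E ->
    B (f z) z /\ w (f z) <= 2 * weight p (B (f z)).
  suff : forall z, exists i, z \in E -> B i z /\ w i <= 2 * weight p (B i).
    by move=> /choice[f fP]; exists f.
  move=> z; have [zE|zE] := boolP (z \in E); last by exists (z, ord0).
  by have [i Biz wi] := Ep z zE; exists i.
have [D [Dt Dp tD]] := disjoint_subfamily B rk [seq f z | z <- E].
have tight i : i \in D -> w i <= 2 * weight p (B i).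
  by move=> /Dt/mapP[z zE ->]; exact: (fP z zE).2.
have pc : c / 2 <= weight p setT.
  (* The enlarged selected balls cover [K], so [c] is at most the sum of the [w i] over [D]; by
     saturation and disjointness this is at most twice the total weight. *)
  have : c <= 2 * weight p setT; last lra.
  rewrite -lee_fin (le_trans cM)//.
  have KD y : K y -> exists2 j, j \in D &
      bowen_ball d phi (rk j)%:R j.1 (4 * e) y.
    move=> /KF[z Fz zy].
    have zE : z \in E by move: Fz; rewrite EF.
    (* Each move costs [e] at time [rk j]: from the centre of [j] to the common point [u], to the
       centre of [f z], to [z], to [y]. When the two balls are equal, trivial moves at [z] fill the
       gap. *)
    have -> : 4 * e = e + (e + (e + e)) by lra.
    have [j jD ij] := tD (f z) (map_f f zE).
    exists j => //; have := (fP z zE).1.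
    have {}zy t : t <= L%:R -> bowen_ball d phi t z e y.
      by move=> tL; exact: bowen_ball_le zy.
    have rkLr i : (rk i)%:R <= L%:R :> R by rewrite ler_nat.
    have cz t : bowen_ball d phi t z e z by exact: bowen_ball_center.
    case: ij => [<- Bjz|[ji [u [Biu Bju]]] Biz].
      apply: (bowen_ball_trans md Bjz); apply: (bowen_ball_trans md (cz _)).
      by apply: (bowen_ball_trans md (cz _)); exact: zy.
    have ijB v : B (f z) v -> bowen_ball d phi (rk j)%:R (f z).1 e v.
      by apply: bowen_ball_le; rewrite ler_nat.
    apply: (bowen_ball_trans md Bju).
    apply: (bowen_ball_trans md (bowen_ball_sym md (ijB _ Biu))).
    by apply: (bowen_ball_trans md (ijB _ Biz)); exact: zy.
  apply: (le_trans (@bowen_M_N_le_sum _ _ _ _ _ _ _ _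
    [seq (i.1, rk i) | i <- D] K0 _ _)).
  - by move=> _ /mapP[i _ ->]; exact: leq_maxl.
  - move=> y /KD[j jD yj]; exists (j.1, rk j) => //.
    by apply/mapP; exists j.
  - rewrite lee_fin big_map /= (le_trans _ (_ : \sum_(i <- D) 2 * weight p (B i) <= _))//.
      by rewrite big_seq [leRHS]big_seq; apply: ler_sum => i /tight.
    by rewrite -mulr_sumr ler_pM2l// sum_disjoint_weight.
have W0 : 0 < weight p setT by apply: lt_le_trans pc; rewrite divr_gt0.
(* Normalising a total weight of at least [c / 2] costs the factor [2 / c]. *)
exists [seq (z.1, (weight p setT)^-1 * z.2) | z <- p]; split.
- by move=> _ /mapP[z zp ->] /=; rewrite mulr_ge0 ?invr_ge0 ?(ltW W0) ?p0.
- by move=> _ /mapP[z /pE zE ->] /=; apply: FK; rewrite EF.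
- by rewrite weight_scale mulVf ?gt_eqF.
- move=> x n /andP[Nn nL]; rewrite weight_scale.
  have n1 : (n < L.+1)%N by rewrite ltnS.
  have := pw (x, Ordinal n1); rewrite /B /w /rk /= (maxn_idPr Nn) => pBn.
  apply: ler_pM => //; [by rewrite invr_ge0 ltW|exact: weight_ge0|].
  by rewrite -[leRHS]invf_div lef_pV2 ?posrE ?divr_gt0.
Qed.

(** * From finitely additive probabilities to Borel probabilities *)

Definition finitely_additive_probability (R : realType) (X : Type)
    (m : set X -> R) :=
  [/\ forall A, 0 <= m A, m setT = 1 &
      forall A B, A `&` B = set0 -> m (A `|` B) = m A + m B].

Section inner_outer.
Context {R : realType} {X : Type} (d : X -> X -> R) (m : set X -> R).
Hypothesis md : is_metric d.
Hypothesis cX : dcompact d [set: X].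
Hypothesis fm : finitely_additive_probability m.

Let m_ge0 A : 0 <= m A. Proof. by case: fm. Qed.

Let mU A B : A `&` B = set0 -> m (A `|` B) = m A + m B.
Proof. by case: fm => _ _; exact. Qed.

Let m0 : m set0 = 0.
Proof.
by have := mU (setI0 set0); rewrite setU0 => /eqP; rewrite -subr_eq subrr eq_sym => /eqP.
Qed.

Let m_le A B : A `<=` B -> m A <= m B.
Proof.
move=> AB; rewrite -(setDUK AB) mU; last by rewrite setDE setICA setICr setI0.
by rewrite lerDl.
Qed.


Let mU_le A B : m (A `|` B) <= m A + m B.
Proof.
have AU : A `<=` A `|` B by exact: subsetUl.
rewrite -(setDUK AU) [leLHS]mU; last by rewrite setDE setICA setICr setI0.
by rewrite lerD2l; apply: m_le => x [[]].
Qed.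

(** The points at distance at least [r] from the complement of [U]. *)
Definition shrink (U : set X) (r : R) := [set x | [set y | d x y < r] `<=` U].

Lemma shrink_sub U r : 0 < r -> shrink U r `<=` U.
Proof. by move=> r0 x; apply; rewrite /= (is_metric_refl md). Qed.

Lemma shrinkS U V r s : U `<=` V -> s <= r -> shrink U r `<=` shrink V s.
Proof.
by move=> UV sr x Ux y /= xy; apply/UV/Ux; exact: lt_le_trans sr.
Qed.

Local Open Scope ereal_scope.

(** Counting only the mass that stays away from the complement makes the content countably
    subadditive on open sets, although [m] is only finitely additive, and keeps it below [m U]. *)
Definition inner_content (U : set X) : \bar R :=
  ereal_sup [set (m (shrink U r))%:E | r in [set r : R | (0 < r)%R]].

Definition open_outer (A : set X) : \bar R :=
  ereal_inf [set inner_content U | U in [set U | dopen d U /\ A `<=` U]].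

Lemma inner_content_ge U r : (0 < r)%R -> (m (shrink U r))%:E <= inner_content U.
Proof. by move=> r0; apply: ereal_sup_ubound; exists r. Qed.

Lemma inner_content_le U : inner_content U <= (m U)%:E.
Proof.
apply: ge_ereal_sup => _ [r r0 <-]; rewrite lee_fin.
by apply: m_le; exact: shrink_sub.
Qed.

Lemma inner_content_ge0 U : 0 <= inner_content U.
Proof. by apply: le_trans (inner_content_ge U ltr01); rewrite lee_fin. Qed.

Lemma inner_contentS U V : U `<=` V -> inner_content U <= inner_content V.
Proof.
move=> UV; apply: ge_ereal_sup => _ [r r0 <-].
apply: le_trans (inner_content_ge V r0); rewrite lee_fin.
by apply: m_le; exact: shrinkS.
Qed.

Lemma inner_content_fin_num U : inner_content U \is a fin_num.
Proof.
rewrite ge0_fin_numE ?inner_content_ge0//.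
exact: le_lt_trans (inner_content_le U) (ltry _).
Qed.

(* By a Lebesgue number argument, each shrinking of the union is covered by
   shrinkings of finitely many of the [U i]. *)
Lemma inner_content_bigcup (U : nat -> set X) : (forall i, dopen d (U i)) ->
  inner_content (\bigcup_i U i) <= \sum_(i <oo) inner_content (U i).
Proof.
move=> oU; apply: ge_ereal_sup => _ [r /= r0 <-]; set V := shrink _ r.
have [k kT] : exists k, [set: X] `<=` [set x | exists2 rho : R,
    (k.+1%:R^-1 < rho)%R & (exists2 i, (i <= k)%N & [set y | (d x y < rho)%R] `<=` U i) \/
                       [set y | (d x y < rho)%R] `&` V = set0].
  apply: (dcompact_nondecreasing cX).
  (* As [rho] is strictly larger than [k.+1%:R^-1], the midpoint is still an admissible radius, and
     the centre may move by the other half of the gap. *)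
  - move=> k x [rho krho H]; exists ((rho - k.+1%:R^-1) / 2)%R.
      by rewrite divr_gt0// subr_gt0.
    move=> y /= xy; exists ((rho + k.+1%:R^-1) / 2)%R.
      by move: krho; move: (k.+1%:R^-1)%R => u; lra.
    have sub : [set z | (d y z < (rho + k.+1%:R^-1) / 2)%R] `<=`
        [set z | (d x z < rho)%R].
      move=> z /=; have := is_metric_triangle md y x z; move: xy.
      by move: (k.+1%:R^-1)%R => u; lra.
    case: H => [[i ik xU]|xV]; [left; exists i => //|right].
      exact: subset_trans xU.
    by rewrite -subset0 -xV; exact: setSI.
  - move=> j k jk x [rho jrho H]; exists rho.
      by apply: le_lt_trans jrho; rewrite lef_pV2 ?posrE// ler_nat.
    case: H => [[i ij xU]|xV]; [left; exists i => //|by right].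
    exact: leq_trans jk.
  - move=> x _.
    suff [rho rho0 [i xi]] : exists2 rho : R, (0 < rho)%R & exists i,
        [set y | (d x y < rho)%R] `<=` U i \/ [set y | (d x y < rho)%R] `&` V = set0.
      have [n _ /(_ n (leqnn n))/= nd] := near_infty_natSinv_lt (PosNum rho0).
      exists (maxn n i) => //; exists rho.
        by apply: le_lt_trans nd; rewrite lef_pV2 ?posrE// ler_nat ltnS leq_maxl.
      case: xi => [xi|xV]; [left; exists i => //|by right].
      exact: leq_maxr.
    have [[i _ Uix]|nUx] := pselect ((\bigcup_i U i) x).
      by have [rho rho0 xU] := oU i x Uix; exists rho => //; exists i; left.
    (* A point outside the union is at distance at least [r] from every point of [V]; the index 0 is
       arbitrary. *)
    exists r => //; exists 0%N; right; rewrite -subset0 => y /= [xy Vy].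
    by apply/nUx/Vy; rewrite /= (is_metric_sym md).
have VU : V `<=` \big[setU/set0]_(i < k.+1) shrink (U i) k.+1%:R^-1.
  move=> x Vx; have [rho krho [[i ik xU]|xV]] := kT x I.
    rewrite -(bigcup_mkord k.+1 (fun i => shrink (U i) k.+1%:R^-1)).
    by exists i => // y /= xy; apply: xU; exact: lt_trans krho.
  exfalso; rewrite -[False]/(set0 x) -xV; split=> //=.
  by rewrite (is_metric_refl md); apply: lt_trans krho; rewrite invr_gt0.
have mbig n (W : nat -> set X) :
    (m (\big[setU/set0]_(i < n) W i) <= \sum_(i < n) m (W i))%R.
  elim: n => [|n ih]; first by rewrite !big_ord0 m0.
  by rewrite !big_ord_recr/=; apply: le_trans (mU_le _ _) _; rewrite lerD2r.
apply: le_trans (_ : (\sum_(i < k.+1) m (shrink (U i) k.+1%:R^-1))%:E <= _).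
  by rewrite lee_fin (le_trans (m_le VU))//; exact: (mbig _ (fun i => shrink (U i) _)).
apply: le_trans (nneseries_lim_ge k.+1 _); last by move=> *; exact: inner_content_ge0.
rewrite -sumEFin big_mkord; apply: lee_sum => i _.
by apply: inner_content_ge; rewrite invr_gt0.
Qed.

Lemma open_outerE U : dopen d U -> open_outer U = inner_content U.
Proof.
move=> oU; apply/eqP; rewrite eq_le; apply/andP; split.
  by apply: ereal_inf_lbound; exists U => //; split.
by apply: le_ereal_inf_tmp => _ [V [_ UV] <-]; exact: inner_contentS.
Qed.

Lemma open_outer_le A U : dopen d U -> A `<=` U -> open_outer A <= inner_content U.
Proof. by move=> oU AU; apply: ereal_inf_lbound; exists U. Qed.

Lemma open_outer_ge0 A : 0 <= open_outer A.
Proof. by apply: le_ereal_inf_tmp => _ [V _ <-]; exact: inner_content_ge0. Qed.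

Lemma open_outerS A B : A `<=` B -> open_outer A <= open_outer B.
Proof.
move=> AB; apply: le_ereal_inf_tmp => _ [V [oV BV] <-].
by apply: open_outer_le => //; exact: subset_trans BV.
Qed.

Lemma open_outer0 : open_outer set0 = 0.
Proof.
apply/eqP; rewrite eq_le open_outer_ge0 andbT.
have := inner_content_le set0; rewrite m0; apply: le_trans; exact: open_outer_le.
Qed.

Lemma open_outer_fin_num A : open_outer A \is a fin_num.
Proof.
rewrite ge0_fin_numE ?open_outer_ge0//.
apply: le_lt_trans (open_outer_le (dopenT d) (@subsetT _ A)) _.
exact: le_lt_trans (inner_content_le _) (ltry _).
Qed.

Lemma open_outer_sigma_subadditive : sigma_subadditive open_outer.
Proof.
move=> F; apply/lee_addgt0Pr => e e0.
have [G GP] : exists G : nat -> set X, forall i, [/\ dopen d (G i), F i `<=` G i &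
    inner_content (G i) <= open_outer (F i) + (e / (2 ^ i.+1)%:R)%:E].
  suff : forall i, exists Gi, [/\ dopen d Gi, F i `<=` Gi &
      inner_content Gi <= open_outer (F i) + (e / (2 ^ i.+1)%:R)%:E].
    by move=> /choice[G GP]; exists G.
  move=> i; have ei : (0 < e / (2 ^ i.+1)%:R)%R by rewrite divr_gt0// ltr0n expn_gt0.
  have [_ [U [oU FU] <-] /ltW Ule] :=
    lb_ereal_inf_adherent ei (open_outer_fin_num (F i)).
  by exists U.
apply: le_trans (epsilon_trick xpredT _ (ltW e0)); last first.
  by move=> n; exact: open_outer_ge0.
have oG i : dopen d (G i) by case: (GP i).
apply: le_trans (_ : inner_content (\bigcup_i G i) <= _).
  apply: open_outer_le; first by apply: dopen_bigcup => i _.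
  by move=> x [i _ Fx]; exists i => //; case: (GP i) => _ + _; exact.
apply: le_trans (inner_content_bigcup oG) _.
apply: lee_nneseries => [i _ _|i _]; first exact: inner_content_ge0.
by case: (GP i).
Qed.

(** For an open [G] containing [A], a shrinking [V] carries almost all the content of [G] inside
    [U]. The interior [W] of the complement of [V] contains the part of [A] outside [U], and [m] is
    additive on [V] and the shrinkings of the part of [G] in [W]. *)
Lemma open_outer_split (A U : set X) : dopen d U ->
  open_outer (A `&` U) + open_outer (A `&` ~` U) <= open_outer A.
Proof.
move=> oU; apply: le_ereal_inf_tmp => _ [G [oG AG] <-].
apply/lee_addgt0Pr => e e0.
have [_ [r /= r0 <-] mVe] := ub_ereal_sup_adherent e0 (inner_content_fin_num (G `&` U)).
set V := shrink (G `&` U) r in mVe.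
pose W := [set x | exists2 rho : R, (0 < rho)%R & [set y | (d x y < rho)%R] `&` V = set0].
have oW : dopen d W.
  move=> x [rho rho0 xV]; exists (rho / 2)%R; first by rewrite divr_gt0.
  move=> y /= xy; exists (rho / 2)%R; first by rewrite divr_gt0.
  rewrite -subset0 -xV => z [/= yz Vz]; split=> //=.
  by have := is_metric_triangle md y x z; lra.
have WV : W `&` V = set0.
  rewrite -subset0 => x [[rho rho0 xV] Vx].
  by rewrite -xV; split=> //=; rewrite (is_metric_refl md).
have AW : A `&` ~` U `<=` G `&` W.
  move=> x [/AG Ox nUx]; split=> //; exists r => //.
  rewrite -subset0 => y /= [xy Vy]; apply: nUx.
  by have /Vy[] : [set z | (d y z < r)%R] x by rewrite /= (is_metric_sym md).
have leU : open_outer (A `&` U) <= inner_content (G `&` U).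
  by apply: open_outer_le; [exact: dopenI|exact: setSI].
have leW : open_outer (A `&` ~` U) <= inner_content (G `&` W).
  by apply: open_outer_le AW; exact: dopenI.
(* [V] and a shrinking of the part in [W] are disjoint, and both lie in the shrinking of [G] by the
   smaller radius. *)
have leG : inner_content (G `&` W) <= inner_content G - (m V)%:E.
  apply: ge_ereal_sup => _ [r' r'0 <-].
  rewrite leeBrDr// -EFinD -mU.
    apply: le_trans (inner_content_ge G (_ : (0 < Num.min r r')%R)).
      rewrite lee_fin; apply: m_le => x [|].
        by apply: shrinkS; [exact: subIsetl|rewrite ge_min lexx orbT].
      by apply: shrinkS; [exact: subIsetl|rewrite ge_min lexx].
    by rewrite lt_min r0.
  rewrite -subset0 -WV; apply: setSI.
  by apply: subset_trans (shrink_sub r'0) _; exact: subIsetr.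
apply: le_trans (leeD leU (le_trans leW leG)) _.
move: mVe; rewrite -/(inner_content (G `&` U)); rewrite -(fineK (inner_content_fin_num (G `&` U))).
rewrite -(fineK (inner_content_fin_num G)) -!EFinB -!EFinD lte_fin lee_fin.
lra.
Qed.

End inner_outer.

(* The outer measure induced by the inner content of [m] restricts to a Borel
   measure, by Caratheodory's theorem. *)
Lemma probability_of_finitely_additive (R : realType) (dX : measure_display)
    (X : measurableType dX) (d : X -> X -> R) (m : set X -> R) :
    is_metric d -> dcompact d [set: X] ->
    @measurable dX X = <<s [set U | dopen d U] >> ->
    finitely_additive_probability m ->
  exists mu : probability X R, forall U, dopen d U -> (mu U <= (m U)%:E)%E.
Proof.
move=> md cX mX fm.
pose om : {outer_measure set X -> \bar R} := HB.pack (open_outer d m)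
  (isOuterMeasure.Build R X (open_outer d m) (open_outer0 md fm)
    (open_outer_ge0 d fm) (@open_outerS _ _ d m)
    (open_outer_sigma_subadditive md cX fm)).
have sub A : measurable A -> om.-caratheodory A.
  rewrite mX; apply: smallest_sub => [|U oU].
    split.
    - exact: caratheodory_measurable_set0.
    - by move=> B; rewrite setTD; exact: caratheodory_measurable_setC.
    - exact: caratheodory_measurable_bigcup.
  by apply: le_caratheodory_measurable => B; exact: open_outer_split.
have sadd : semi_sigma_additive (open_outer d m : set X -> \bar R).
  move=> F mF tF mUF.
  apply: (@caratheodory_measure_sigma_additive R X om) => // [i|]; exact: sub.
have T1 : open_outer d m [set: X] = 1%E.
  rewrite open_outerE//; last exact: dopenT.
  case: (fm) => _ mT _; apply/eqP; rewrite eq_le -[1%E]/(1%:E) -mT.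
  rewrite inner_content_le//=.
  apply: le_trans (inner_content_ge d m setT ltr01); rewrite lee_fin.
  by rewrite (_ : shrink _ _ _ = setT)//; apply/seteqP; split.
pose nu : {measure set X -> \bar R} := HB.pack (open_outer d m)
  (isMeasure.Build _ _ _ (open_outer d m) (open_outer0 md fm)
    (open_outer_ge0 d fm) sadd).
pose mu : probability X R := HB.pack (Measure.sort nu)
  (Measure_isProbability.Build _ _ _ nu T1).
by exists mu => U oU; rewrite /= /mu/= open_outerE// inner_content_le.
Qed.

(** * Limits along an ultrafilter *)

(** The image filter clusters in the compact segment, and an ultrafilter converges to each of its
    cluster points. *)
Lemma ultra_bounded_is_cvg (R : realType) (T : Type) (G : set_system T)
    (f : T -> R) (a b : R) :
  UltraFilter G -> (forall t, a <= f t <= b) -> cvg (f t @[t --> G]).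
Proof.
move=> uG fab; have pG : ProperFilter G by exact: ultra_proper.
have [|l [_ fl]] := @segment_compact R a b (f @ G) _.
  by apply: (@filterE T G _ (f @^-1` _)) => t; rewrite /= in_itv/= fab.
apply/cvg_ex; exists l => V Vl.
have [//|GV] := in_ultra_setVsetC (f @^-1` V) uG.
by have [y [/= nVy Vy]] := fl (~` V) V GV Vl.
Qed.

(** The limits exist on all subsets at once, so finite additivity and eventual bounds pass to the
    limit. *)
Lemma ultra_lim_finitely_additive (R : realType) (T X : Type)
    (G : set_system T) (q : T -> set X -> R) :
    UltraFilter G -> (forall t, finitely_additive_probability (q t)) ->
  finitely_additive_probability (fun A => lim (q t A @[t --> G])) /\
  forall A (c : R), (\forall t \near G, q t A <= c) -> lim (q t A @[t --> G]) <= c.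
Proof.
move=> uG fq; have pG : ProperFilter G by exact: ultra_proper.
have qcvg A : cvg (q t A @[t --> G]).
  apply: (@ultra_bounded_is_cvg _ _ _ _ 0 1) => // t.
  case: (fq t) => q0 qT qU; rewrite q0/= -qT -(setUv A) qU ?setICr//.
  by rewrite lerDl.
split=> [|A c]; last exact: limr_le.
split=> [A||A B AB].
- by apply: limr_ge => //; apply: filterE => t; case: (fq t).
- apply: cvg_lim => //; rewrite (_ : (fun t => _) = cst 1); first exact: cvg_cst.
  by apply/funext => t; case: (fq t).
- rewrite -limD//; congr (lim (_ @ G)); apply/funext => t.
  by case: (fq t) => _ _ ->.
Qed.

Lemma weight_finitely_additive (R : realType) (X : choiceType)
    (p : seq (X * R)) : nonneg_weights p -> weight p setT = 1 ->
  finitely_additive_probability (weight p).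
Proof.
by move=> p0 p1; split=> // [A|A B]; [exact: weight_ge0|exact: weightU].
Qed.

Lemma dopen_measurable (R : realType) (dX : measure_display)
    (X : measurableType dX) (d : X -> X -> R) (U : set X) :
    @measurable dX X = <<s [set U | dopen d U] >> -> dopen d U -> measurable U.
Proof. by move=> ->; exact: sub_sigma_algebra. Qed.

(** * The dynamical Frostman measure *)

Lemma dynamical_frostman (R : realType) (dX : measure_display)
    (X : measurableType dX) (d : X -> X -> R) (phi : X -> R -> X) (K : set X)
    (s e c : R) (N : nat) :
    is_metric d -> dcompact d [set: X] ->
    @measurable dX X = <<s [set U | dopen d U] >> ->
    is_flow d phi -> dcompact d K -> K !=set0 ->
    0 <= s -> 0 < e -> 0 < c ->
    (c%:E <= bowen_M_N d phi K s N (4 * e))%E ->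
  exists mu : probability X R, mu K = 1%E /\ forall x n, (N <= n)%N ->
    (mu (bowen_ball d phi n%:R x e) <= (2 / c * expR (- (n%:R * s)))%:E)%E.
Proof.
move=> md cX mX fphi cK K0 s0 e0 c0 cM.
(* The final time is [L + N], so that it is at least [N] for every [L]. *)
have [p pP] := choice (fun L =>
  finite_dynamical_frostman md fphi cK K0 s0 e0 c0 (leq_addr L N) cM).
have [G [uG ooG]] := ultraFilterLemma (@eventually_filter).
have pG : ProperFilter G by exact: ultra_proper.
have [L|fm mle] := ultra_lim_finitely_additive (q := fun L => weight (p L)) uG.
  by case: (pP L) => p0 _ pT _; exact: weight_finitely_additive.
have [mu muP] := probability_of_finitely_additive md cX mX fm.
have oC := dcompact_closed md cK.
have mK : measurable K.
  by rewrite -[K]setCK; apply: measurableC; exact: dopen_measurable oC.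
exists mu; split.
  apply/eqP; rewrite eq_le probability_le1//=.
  (* [m] bounds [mu] from above on open sets only, so [mu K = 1] is obtained from the open
     complement of [K], where no weight lies. *)
  have : (mu (~` K) <= 0)%E.
    apply: le_trans (muP _ oC) _; rewrite lee_fin; apply: mle.
    apply: filterE => L; case: (pP L) => p0 pK pT _.
    have := weightU (p L) (setICr K).
    by rewrite setUv (weight_supp pK) -[LHS]addr0 => /addrI <-.
  by rewrite probability_setC// leeBlDr ?add0e// fin_num_measure.
move=> x n Nn; apply: le_trans (muP _ _) _; first exact: dopen_bowen_ball.
(* The constraint at time [n] holds for all [L >= n], hence along the ultrafilter, which refines the
   filter at infinity. *)
rewrite lee_fin; apply: mle; apply: ooG; exists n => // L /= nL.
by case: (pP L) => _ _ _; apply; rewrite Nn/= (leq_trans nL)// leq_addl.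
Qed.

(** * Integrals without measurability of the integrand *)

Section integral_nonmeasurable.
Import HBNNSimple.
Context {R : realType} {dX : measure_display} {X : measurableType dX}.
Variable mu : probability X R.
Local Open Scope ereal_scope.

(** The integral of a non-negative function is a supremum over the simple functions below it, and
    the constant is one of them. *)
Lemma cst_le_integral (f : X -> \bar R) (s : R) :
  (0 <= s)%R -> (forall x, s%:E <= f x) -> s%:E <= \int[mu]_x f x.
Proof.
move=> s0 sf; rewrite ge0_integralTE; last first.
  by move=> x; apply: le_trans (sf x); rewrite lee_fin.
apply: ereal_sup_ubound => /=; exists (cst_nnsfun X (NngNum s0)) => //.
rewrite (eq_sintegral ((cst s) \_ setT)); last by move=> x; rewrite patchE in_setT.
by rewrite (sintegral_EFin_cst mu setT (NngNum s0)) [X in _ * X]probability_setT mule1.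
Qed.

(** Almost everywhere comparison is applied to each simple function below [f], which is measurable,
    instead of [f]. *)
Lemma integral_le_cst (f : X -> \bar R) (s : R) :
    (0 <= s)%R -> (forall x, 0 <= f x) ->
    mu.-negligible [set x | s%:E < f x] ->
  \int[mu]_x f x <= s%:E.
Proof.
move=> s0 f0 nf; rewrite ge0_integralTE//; apply: ge_ereal_sup => _ [h hf <-].
rewrite (eq_sintegral (h \_ setT)); last by move=> x; rewrite patchE in_setT.
rewrite -integral_nnsfun//.
apply: le_trans (_ : \int[mu]_x cst s%:E x <= _); last first.
  by rewrite integral_cst// [X in _ * X]probability_setT mule1.
apply: ae_ge0_le_integral => //=; first by move=> x _; rewrite lee_fin.
- exact/measurable_EFinP/measurable_funPT.
- apply: negligibleS nf => x /= /not_implyP[_ /negP]; rewrite -ltNge => sh.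
  exact: lt_le_trans (hf x).
Qed.

End integral_nonmeasurable.

(** * Lower limits along a filter *)

Section limf_einf.
Context {R : realType} (f : R -> \bar R) (F : set_system R) {FF : Filter F}.
Local Open Scope ereal_scope.

Lemma limf_einf_ge (c : \bar R) : (\forall t \near F, c <= f t) -> c <= limf_einf f F.
Proof.
move=> cf; rewrite limf_einfE; apply: le_ereal_sup_tmp.
exists (ereal_inf (f @` [set t | c <= f t])); first by exists [set t | c <= f t].
by apply: le_ereal_inf_tmp => _ [t ct <-].
Qed.

Lemma limf_einf_gt (c : \bar R) : c < limf_einf f F -> \forall t \near F, c < f t.
Proof.
rewrite limf_einfE => /ereal_sup_gt[_ [V FV <-] cV].
apply: filterS FV => t Vt; apply: (lt_le_trans cV).
by apply: ereal_inf_lbound; exists t.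
Qed.

End limf_einf.

(** * Measure bounds and exponential rates *)

Section neg_log_rate.
Context {R : realType} {dX : measure_display} {X : measurableType dX}.
Variable mu : probability X R.
Local Open Scope ereal_scope.

Lemma neg_log_rate_ge (B : set X) (t r C : R) : measurable B ->
    (0 < t)%R -> (0 < C)%R -> mu B <= (C * expR (- (t * r)))%:E ->
  (r - ln C / t)%:E <= neg_log_rate mu B t.
Proof.
move=> mB t0 C0; rewrite /neg_log_rate; case: ifPn => [_ _|mB0]; first exact: leey.
have fB : mu B \is a fin_num by exact: fin_num_measure.
have B0 : (0 < fine (mu B))%R.
  by rewrite fine_gt0// lt0e mB0 measure_ge0 ltey_eq fB.
rewrite -{1}(fineK fB) !lee_fin => BC.
have := BC; rewrite -ler_ln ?posrE ?mulr_gt0 ?expR_gt0//.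
rewrite lnM ?posrE ?expR_gt0// expRK => lnB.
rewrite -[r in leLHS](mulfK (lt0r_neq0 t0)) -mulrBl -mulNr ler_pM2r ?invr_gt0//.
lra.
Qed.

Lemma neg_log_rate_ge0 (B : set X) (t : R) : measurable B -> (0 < t)%R ->
  0 <= neg_log_rate mu B t.
Proof.
move=> mB t0; have := @neg_log_rate_ge B t 0 1 mB t0 ltr01.
rewrite ln1 mul0r subrr; apply.
by rewrite mulr0 oppr0 expR0 mulr1 probability_le1.
Qed.

Lemma neg_log_rate_gt (B : set X) (t s : R) : measurable B -> (0 < t)%R ->
  s%:E < neg_log_rate mu B t -> mu B <= (expR (- (t * s)))%:E.
Proof.
move=> mB t0; rewrite /neg_log_rate; case: ifPn => [/eqP-> _|mB0].
  by rewrite lee_fin expR_ge0.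
have fB : mu B \is a fin_num by exact: fin_num_measure.
have B0 : (0 < fine (mu B))%R.
  by rewrite fine_gt0// lt0e mB0 measure_ge0 ltey_eq fB.
rewrite lte_fin -mulNr ltr_pdivlMr// => st; rewrite -(fineK fB) lee_fin.
rewrite -[leLHS](lnK B0) ler_expR; lra.
Qed.

End neg_log_rate.

(** * The critical exponent of Bowen covers *)

Section bowen_M.
Context {R : realType} {X : Type} (d : X -> X -> R) (phi : X -> R -> X).
Context (K : set X).
Local Open Scope ereal_scope.

Lemma bowen_M_N_ge0 s N e : 0 <= bowen_M_N d phi K s N e.
Proof.
apply: le_ereal_inf_tmp => _ [I [x [n [_ _ ->]]]].
by apply: esum_ge0 => i _; rewrite lee_fin expR_ge0.
Qed.

Lemma bowen_M_N_nondecreasing s e :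
  {homo (fun N => bowen_M_N d phi K s N e) : m n / (m <= n)%N >-> m <= n}.
Proof.
move=> M N MN; apply: ereal_inf_le_tmp => v [I [x [n [In KI ->]]]].
by exists I, x, n; split=> // i /In; exact: leq_trans.
Qed.

(** The limit of this non-negative nondecreasing sequence is its supremum. *)
Lemma bowen_M_lam_eq0 s e :
  bowen_M_lam d phi K s e = 0 <-> forall N, bowen_M_N d phi K s N e = 0.
Proof.
have := ereal_nondecreasing_cvgn (@bowen_M_N_nondecreasing s e).
move=> /cvg_lim - /(_ (@ereal_hausdorff R)) limM; split=> [M0 N|M0].
  apply/eqP; rewrite eq_le bowen_M_N_ge0 andbT -M0 /bowen_M_lam limM.
  by apply: ereal_sup_ubound; exists N.
rewrite /bowen_M_lam (_ : (fun N => _) = cst 0); first exact: lim_cst.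
by apply/funext.
Qed.

(** If [s <= 0], every ball contributes at least 1, and a cover of a non-empty set has at least one
    ball. *)
Lemma bowen_M_lam_gt0 s e : K !=set0 -> bowen_M_lam d phi K s e = 0 -> (0 < s)%R.
Proof.
move=> [y Ky] /bowen_M_lam_eq0/(_ 0%N) M0; rewrite ltNge; apply/negP => s0.
suff : 1 <= bowen_M_N d phi K s 0 e by rewrite M0 lee_fin ler10.
apply: le_ereal_inf_tmp => _ [I [x [n [_ KI ->]]]].
have [i Ii _] := KI y Ky.
apply: esum_ge; exists [set i].
  by split=> [|_ ->]; first exact: finite_set1.
rewrite fsbig_set1 lee_fin -expR0 ler_expR oppr_ge0.
exact: mulr_ge0_le0.
Qed.

Lemma bowen_M_ge0 e : K !=set0 -> 0 <= bowen_M d phi K e.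
Proof.
move=> K0; apply: le_ereal_inf_tmp => _ [s /= /(bowen_M_lam_gt0 K0)/ltW s0 <-].
by rewrite lee_fin.
Qed.

End bowen_M.

(** * The two inequalities at a fixed scale *)

Section variational.
Context {R : realType} {dX : measure_display} {X : measurableType dX}.
Context (d : X -> X -> R) (phi : X -> R -> X) (K : set X).
Hypothesis md : is_metric d.
Hypothesis cX : dcompact d [set: X].
Hypothesis mX : @measurable dX X = <<s [set U | dopen d U] >>.
Hypothesis fphi : is_flow d phi.
Hypothesis cK : dcompact d K.
Hypothesis K0 : K !=set0.
Local Open Scope ereal_scope.

Let mball t x e : measurable (bowen_ball d phi t x e).
Proof. by apply: (dopen_measurable mX); exact: dopen_bowen_ball. Qed.

Let mK : measurable K.
Proof.
rewrite -[K]setCK; apply: measurableC; apply: (dopen_measurable mX).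
exact: dcompact_closed.
Qed.

Lemma local_entropy_ge0 (mu : probability X R) x e :
  0 <= limf_einf (fun t : R => neg_log_rate mu (bowen_ball d phi t x e) t) +oo%R.
Proof.
apply: limf_einf_ge; near=> t; exact: neg_log_rate_ge0.
Unshelve. all: by end_near. Qed.

Lemma le_lower_BK (mu : probability X R) (s e C : R) (N : nat) :
    (0 <= s)%R -> (0 < C)%R ->
    (forall x n, (N <= n)%N ->
      mu (bowen_ball d phi n%:R x e) <= (C * expR (- (n%:R * s)))%:E) ->
  s%:E <= lower_BK d phi mu e.
Proof.
move=> s0 C0 muC; apply: cst_le_integral => // x.
(* The factor [expR s] pays for replacing a real time by its integer part; the term [ln C' / t] then
   vanishes in the limit. *)
pose C' := (C * expR s)%R.
have C'0 : (0 < C')%R by rewrite mulr_gt0// expR_gt0.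
apply/lee_addgt0Pr => eta eta0; rewrite -leeBlDr//.
apply: limf_einf_ge; near=> t.
have t0 : (0 < t)%R by near: t; exact: nbhs_pinfty_gt.
apply: le_trans (_ : (s - ln C' / t)%:E <= _).
  by rewrite -EFinB lee_fin lerD2l lerN2 ler_pdivrMr// mulrC -ler_pdivrMr//.
apply: neg_log_rate_ge => //.
have /andP[nt tn] := truncn_itv (ltW t0).
apply: le_trans (_ : mu (bowen_ball d phi (Num.trunc t)%:R x e) <= _).
  by apply: le_measure; rewrite ?inE//; exact: bowen_ball_le.
apply: (le_trans (muC _ _ _)).
  rewrite truncn_ge_nat ?(ltW t0)//; near: t; apply: nbhs_pinfty_ge; exact: num_real.
rewrite lee_fin -mulrA ler_pM2l// -expRD ler_expR.
have : (t * s <= (Num.trunc t).+1%:R * s)%R by rewrite ler_wpM2r// ltW.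
rewrite -natr1 mulrDl mul1r; lra.
Unshelve. all: by end_near. Qed.

Lemma bowen_M_le_sup_lower_BK (e : R) : (0 < e)%R ->
  bowen_M d phi K (4 * e)%R <=
  ereal_sup [set lower_BK d phi mu e
            | mu in [set mu : probability X R | mu K = 1]].
Proof.
move=> e0; set S := ereal_sup _.
have sS s : (0 <= s)%R -> bowen_M_lam d phi K s (4 * e) <> 0 -> s%:E <= S.
  move=> s0 Ms.
  have [N MN] : exists N, bowen_M_N d phi K s N (4 * e) <> 0.
    by apply/existsNP => MN; exact/Ms/bowen_M_lam_eq0.
  have {}MN : 0 < bowen_M_N d phi K s N (4 * e).
    by rewrite lt0e bowen_M_N_ge0 andbT; exact/eqP.
  (* An infinite value of [bowen_M_N] is replaced by the constant 1. *)
  have [c c0 cM] : exists2 c : R, (0 < c)%R & c%:E <= bowen_M_N d phi K s N (4 * e).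
    case: (bowen_M_N _ _ _ _ _ _) MN => [c||//]; first by exists c.
    by exists 1%R => //; exact: leey.
  have [mu [muK muC]] := dynamical_frostman md cX mX fphi cK K0 s0 e0 c0 cM.
  apply: le_ereal_sup_tmp; exists (lower_BK d phi mu e); first by exists mu.
  by apply: le_lower_BK muC => //; rewrite divr_gt0.
have S0 : 0 <= S.
  by apply: sS => // /(bowen_M_lam_gt0 K0); rewrite ltxx.
case: S S0 sS => [S S0 sS|_ _|]; [|exact: leey|by rewrite leeNy_eq].
(* At the exponent [S + eta] the limit must vanish, since otherwise [sS] would give
   [S + eta <= S]. *)
apply/lee_addgt0Pr => eta eta0; rewrite -EFinD.
apply: ereal_inf_lbound; exists (S + eta)%R => //=.
apply: contrapT => /sS; rewrite !lee_fin in S0 *.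
by move=> /(_ (addr_ge0 S0 (ltW eta0))); rewrite gerDl leNgt eta0.
Qed.

(* Every point of [K] whose lower local entropy exceeds [s] lies in one of the
   null sets [A N]: a ball of radius [e / 2] of a cover that meets [A N] is
   contained in a ball of radius [e] of measure at most [exp (- n s)]. *)
Lemma lower_BK_le (mu : probability X R) (s e : R) : mu K = 1 ->
  bowen_M_lam d phi K s (e / 2) = 0 -> lower_BK d phi mu e <= s%:E.
Proof.
move=> muK Ms0; have /ltW s0 := bowen_M_lam_gt0 K0 Ms0.
have MN0 := (bowen_M_lam_eq0 _ _ _ _ _).1 Ms0.
apply: integral_le_cst => // [x|]; first exact: local_entropy_ge0.
pose A (N : nat) := [set x | K x /\ forall n, (N <= n)%N ->
   mu (bowen_ball d phi n%:R x e) <= (expR (- (n%:R * s)))%:E].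
apply: (@negligibleS _ _ _ _ (~` K `|` \bigcup_N A N)).
  move=> x /= sx; have [Kx|] := pselect (K x); last by left.
  right; have [T [_ TV]] := limf_einf_gt sx.
  (* This integer exceeds [T] and is positive, so that the rate at time [n] is a genuine
     quotient. *)
  exists (Num.trunc T).+1 => //; split=> // n Tn.
  apply: neg_log_rate_gt => //; first by rewrite ltr0n (leq_trans _ Tn).
  by apply: TV; rewrite (lt_le_trans (truncnS_gt T))// ler_nat.
apply: negligibleU.
  exists (~` K); split=> //; first exact: measurableC.
  by rewrite [LHS]probability_setC// [X in _ - X]muK subee.
apply: negligible_bigcup => N.
have cover k : exists G : set X, [/\ measurable G, A N `<=` G & mu G <= k.+1%:R^-1%:E].
  have k0 : 0 < k.+1%:R^-1%:E :> \bar R by rewrite lte_fin invr_gt0.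
  (* As the infimum over covers is 0, some cover has sum below [k.+1%:R^-1]. *)
  rewrite -(MN0 N) in k0.
  have [_ [I [x [n [In KI ->]]]] Ik] := ereal_inf_lt k0.
  pose J i := I i /\ bowen_ball d phi (n i)%:R (x i) (e / 2) `&` A N !=set0.
  (* The measure of a ball is controlled only if it meets [A N]; the others are emptied. *)
  pose F i := if `[< J i >] then bowen_ball d phi (n i)%:R (x i) (e / 2) else set0.
  have mF i : measurable (F i) by rewrite /F; case: ifP.
  exists (\bigcup_i F i); split; first exact: bigcupT_measurable.
    move=> y Ay; have [i Ii yi] := KI y Ay.1.
    exists i => //; rewrite /F ifT//; apply/asboolP; split=> //.
    by exists y.
  apply: le_trans (ltW Ik).
  apply: le_trans (measure_sigma_subadditive mu mF (bigcupT_measurable _ mF)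
    (@subset_refl _ _)) _.
  have -> : I = [set i | i \in I] by rewrite set_mem_set.
  rewrite -nneseries_esum; last by move=> i _; rewrite lee_fin expR_ge0.
  rewrite [leRHS]eseries_mkcond; apply: lee_nneseries => // i _.
  rewrite /F; case: ifPn => [/asboolP[Ii [y [yi Ay]]]|_]; last first.
    by rewrite measure0; case: ifP => // _; rewrite lee_fin expR_ge0.
  rewrite ifT; last exact/mem_set.
  apply: le_trans (Ay.2 _ (In _ Ii)).
  apply: le_measure; rewrite ?inE// => z zi.
  have -> : e = (e / 2 + e / 2)%R by lra.
  exact: bowen_ball_trans (bowen_ball_sym md yi) zi.
have [G GP] := choice cover.
exists (\bigcap_k G k); split.
- by apply: bigcapT_measurable => k; case: (GP k).
- apply/eqP; rewrite eq_le measure_ge0 andbT; apply/lee_addgt0Pr => eta eta0.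
  rewrite add0e.
  have [k _ /(_ k (leqnn k))/= /ltW keta] := near_infty_natSinv_lt (PosNum eta0).
  case: (GP k) => mG _ Gk; apply: le_trans (le_trans Gk _); last by rewrite lee_fin.
  apply: le_measure; rewrite ?inE//; last exact: bigcap_inf.
  by apply: bigcapT_measurable => j; case: (GP j).
- by move=> x Ax k _; case: (GP k) => _ + _; exact.
Qed.

Lemma sup_lower_BK_le_bowen_M (e : R) :
  ereal_sup [set lower_BK d phi mu e
            | mu in [set mu : probability X R | mu K = 1]] <=
  bowen_M d phi K (e / 2)%R.
Proof.
apply: ge_ereal_sup => _ [mu muK <-]; apply: le_ereal_inf_tmp => _ [s Ms <-].
exact: lower_BK_le.
Qed.

End variational.

(** * Rescaling and conclusion *)

(** Dividing [e] by [c] adds the constant [ln c] to [ln (1 / e)], which tends to infinity, so the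
    ratio of the two logarithms tends to 1. *)
Lemma limf_esup_ln_rescale (R : realType) (f g : R -> \bar R) (c : R) :
    1 <= c -> (forall e, 0 < e -> (0 <= f e)%E) ->
    (forall e, 0 < e -> (g e <= f (e / c)%R)%E) ->
  (limf_esup (fun e : R => g e * (ln (1 / e))^-1%:E) 0^'+ <=
   limf_esup (fun e : R => f e * (ln (1 / e))^-1%:E) 0^'+)%E.
Proof.
move=> c1 f0 gf; apply: le_ereal_inf_tmp => _ [V [r /= r0 rV] <-].
have {}rV e : 0 < e -> e < r -> V e.
  by move=> e0 er; apply: rV => //=; rewrite sub0r normrN gtr0_norm.
have ln_gt0 e : 0 < e -> e < 1 -> 0 < ln (1 / e) :> R.
  by move=> e0 e1; rewrite ln_gt0// div1r invf_gt1.
have c0 : 0 < c by lra.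
set S := ereal_sup _.
have SV e : 0 < e -> e < r -> (f e * (ln (1 / e))^-1%:E <= S)%E.
  by move=> e0 er; apply: ereal_sup_ubound; exists e => //; exact: rV.
have S0 : (0 <= S)%E.
  have m0 : 0 < Num.min (r / 2) (1 / 2) by rewrite lt_min !divr_gt0.
  apply: le_trans (SV _ m0 _); last by rewrite gt_min; apply/orP; left; lra.
  apply: mule_ge0; first exact: f0.
  rewrite lee_fin invr_ge0 ltW// ln_gt0//.
  by rewrite gt_min; apply/orP; right; lra.
case: S S0 SV => [S S0 SV|_ _|]; [|exact: leey|by rewrite leeNy_eq].
rewrite lee_fin in S0.
apply/lee_addgt0Pr => del del0; rewrite -EFinD.
(* With this choice [(1 + eta) * S <= S + del]; the 1 covers the case [S = 0]. *)
pose eta := del / (S + 1).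
have eta0 : 0 < eta by rewrite divr_gt0//; lra.
(* The bound 1 makes the logarithm positive, and the exponential gives
   [ln c <= eta * ln (1 / e)]. *)
pose r' := Num.min r (Num.min 1 (expR (- (ln c / eta)))).
apply: ge_ereal_inf; exists (ereal_sup
    [set (g e * (ln (1 / e))^-1%:E)%E | e in [set e | 0 < e < r']]).
  exists [set e | 0 < e < r'] => //; near=> e; apply/andP; split => //.
  by near: e; apply: nbhs_right_lt; rewrite !lt_min r0 ltr01 expR_gt0.
apply: ge_ereal_sup => _ [e /= /andP[e0 er'] <-].
move: er'; rewrite !lt_min => /and3P[er e1 eeta].
have le0 := ln_gt0 e e0 e1.
have ec0 : 0 < e / c by rewrite divr_gt0.
have ece : e / c <= e by rewrite ler_pdivrMr// ler_peMr// ltW.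
have lec : ln (1 / (e / c)) = ln c + ln (1 / e).
  by rewrite -lnM ?posrE ?divr_gt0//; congr ln; rewrite !div1r invf_div.
have lce : ln c <= eta * ln (1 / e).
  rewrite -ler_pdivrMl// mulrC div1r lnV ?posrE// lerNr.
  by rewrite -[leRHS]expRK ler_ln ?posrE ?expR_gt0// ltW.
have lc0 : 0 <= ln c by exact: ln_ge0.
have inv_le : (ln (1 / e))^-1 <= (1 + eta) * (ln (1 / (e / c)))^-1.
  rewrite lec ler_pdivlMr; last exact: ltr_wpDl.
  by rewrite mulrC ler_pdivrMr// mulrDl [1 * ln _]mul1r addrC lerD2l.
apply: le_trans (_ : f (e / c)%R * (ln (1 / e))^-1%:E <= _)%E.
  by apply: lee_wpmul2r; [rewrite lee_fin invr_ge0 ltW|exact: gf].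
apply: le_trans (_ : (1 + eta)%:E * (f (e / c)%R * (ln (1 / (e / c)))^-1%:E) <= _)%E.
  rewrite muleCA -EFinM; apply: lee_wpmul2l; first exact: f0.
  by rewrite lee_fin.
apply: le_trans (_ : (1 + eta)%:E * S%:E <= _)%E.
  apply: lee_wpmul2l; first by rewrite lee_fin; lra.
  by apply: SV => //; exact: le_lt_trans er.
rewrite -EFinM lee_fin mulrDl mul1r lerD2l /eta mulrAC ler_pdivrMr; last lra.
by rewrite ler_pM2l//; lra.
Unshelve. all: by end_near. Qed.

Theorem theorem1p2 (R : realType) (dX : measure_display) (X : measurableType dX)
    (d : X -> X -> R) (phi : X -> R -> X) (K : set X) :
  is_metric d ->
  dcompact d setT ->
  (@measurable dX X = <<s [set U | dopen d U] >>) ->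
  is_flow d phi ->
  dcompact d K -> K !=set0 ->
  bowen_umdim d phi K =
  limf_esup (fun eps : R =>
      (ereal_sup [set lower_BK d phi mu eps
                 | mu in [set mu : probability X R | mu K = 1%E]]
       * (ln (1 / eps))^-1%:E)%E) (0^'+).
Proof.
move=> md cX mX fphi cK K0; apply/eqP; rewrite eq_le; apply/andP; split.
  apply: (@limf_esup_ln_rescale _ _ _ 4) => [|e e0|e e0]; first lra.
    apply: le_trans (bowen_M_le_sup_lower_BK md cX mX fphi cK K0 e0).
    exact: bowen_M_ge0.
  have e40 : 0 < e / 4 by rewrite divr_gt0.
  have := bowen_M_le_sup_lower_BK md cX mX fphi cK K0 e40.
  by rewrite mulrC divfK.
apply: (@limf_esup_ln_rescale _ _ _ 2) => [|e e0|e e0]; first lra.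
  exact: bowen_M_ge0.
exact: sup_lower_BK_le_bowen_M.
Qed.
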